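(* Let $f:\mathcal H\to(-\infty,+\infty]$ be a proper closed convex function, let $T=\partial f$, and let $f_{\mathrm{inf}}(z_* ):=\inf_{z_{**}\in H_{**}}f(z_*,z_{**})$ for $z_*\in H_*$. Suppose there exists $\hat z_*\in\operatorname{dom}f_{\mathrm{inf}}$ such that $$\operatorname*{argmin}_{z_{**}\in H_{**}}f(\hat z_*,z_{**})$$ is nonempty and bounded. Then $f_{\mathrm{inf}}$ is closed, proper, and convex, and for every $z_*\in\operatorname{dom}f_{\mathrm{inf}}$ the set $\operatorname*{argmin}_{z_{**}\in H_{**}}f(z_*,z_{**})$ is nonempty and bounded. Moreover, $$T_*=\partial f_{\mathrm{inf}},$$ and $$T_{**}(z_*,w_* )=\operatorname*{argmin}_{z_{**}\in H_{**}}f(z_*,z_{**})\qquad\forall\,(z_*,w_* )\in\operatorname{gph}T_*.$$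
   Context: $\mathcal H$ is a finite-dimensional Hilbert space with an orthogonal decomposition $\mathcal H=H_*\oplus H_{**}$ into subspaces; each $z\in\mathcal H$ is written $z=(z_*,z_{**})$ with $z_*\in H_*$, $z_{**}\in H_{**}$ its orthogonal components. $\partial$ is the subdifferential of convex analysis, and $\operatorname{dom}f_{\mathrm{inf}}=\{z_*\mid f_{\mathrm{inf}}(z_* )<+\infty\}$. The projected mapping $T_*:H_*\rightrightarrows H_*$ and the completion mapping $T_{**}:H_*\times H_*\rightrightarrows H_{**}$ are defined by $$w_*\in T_*(z_* )\iff\exists z_{**}\in H_{**}\text{ such that }(w_*,0)\in T(z_*,z_{**}),$$ $$T_{**}(z_*,w_* ):=\{z_{**}\in H_{**}\mid(w_*,0)\in T(z_*,z_{**})\}.$$ *)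

(* Defs.v *)
From HB Require Import structures.
From mathcomp Require Import all_boot all_order all_algebra.
From mathcomp Require Import all_classical all_reals all_analysis.

Set Implicit Arguments.
Unset Strict Implicit.
Unset Printing Implicit Defensive.

Import Order.TTheory GRing.Theory Num.Theory.
Import numFieldNormedType.Exports.

Local Open Scope classical_set_scope.
Local Open Scope ring_scope.

(* Finite-dimensional real Hilbert spaces: the topology of V is that of its
   norm, and the norm is the one induced by the inner product. *)
HB.mixin Record hasInner (R : realType) V & NormedModule R V & Vector R V := {
  inner : {dot V for (idfun : R -> R)};
  inner_norm : forall x : V, `|x| ^+ 2 = inner x x
}.

#[short(type="hilbertType")]
HB.structure Definition Hilbert (R : realType) :=
  {V of NormedModule R V & Vector R V & hasInner R V}.

(* A subspace of a finite-dimensional Hilbert space, as a Hilbert space in its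
   own right for the restricted norm and inner product. *)
Section SubHilbert.
Context {R : realType} {V : hilbertType R} (U : {vspace V}).

Let snorm (x : subvs_of U) : R := `|vsval x|.

Let snormD x y : snorm (x + y) <= snorm x + snorm y.
Proof. by rewrite /snorm linearD ler_normD. Qed.

Let snormZ (l : R) x : snorm (l *: x) = `|l| * snorm x.
Proof. by rewrite /snorm linearZ normrZ. Qed.

Let snorm0 x : snorm x = 0 -> x = 0.
Proof. by move/normr0_eq0 => x0; apply: val_inj. Qed.

HB.instance Definition _ :=
  Lmodule_isNormed.Build R (subvs_of U) snormD snormZ snorm0.

Definition sub_inner (x y : subvs_of U) : R :=
  (inner : V -> V -> R) (vsval x) (vsval y).

Let sub_inner_bilinear :
  bilinear_for ( *%R : R -> R -> R) ((idfun : R -> R) \; *%R) sub_inner.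
Proof.
split=> [u' a x y|u a x y]; rewrite /sub_inner linearP //.
exact: linearPl.
Qed.

Let sub_inner_sym (x y : subvs_of U) :
  sub_inner x y = (-1) ^+ false * idfun (sub_inner y x).
Proof. exact: hermitian_subproof. Qed.

Let sub_inner_pos (x : subvs_of U) : x != 0 -> 0 < sub_inner x x.
Proof.
move=> x0; apply: neq0_dnorm_gt0.
by apply: contra_neq x0 => x0; apply: val_inj.
Qed.

HB.instance Definition _ := @bilinear_isBilinear.Build R _ _ _ _ _ sub_inner
  sub_inner_bilinear.
HB.instance Definition _ :=
  @isHermitianSesquilinear.Build R _ false idfun sub_inner sub_inner_sym.
HB.instance Definition _ := @isDotProduct.Build R _ sub_inner sub_inner_pos.

Let sub_inner_norm (x : subvs_of U) :
  `|x| ^+ 2 = (sub_inner : {dot (subvs_of U) for (idfun : R -> R)}) x x.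
Proof. exact: (inner_norm (vsval x)). Qed.

HB.instance Definition _ := @hasInner.Build R (subvs_of U)
  sub_inner sub_inner_norm.

End SubHilbert.

Section ConvexAnalysis.
Context {R : realType} {V : hilbertType R}.
Implicit Type f : V -> \bar R.

Definition edom f : set V := [set x | (f x < +oo)%E].

Definition epigraph f : set (V * R^o) := [set p | (f p.1 <= p.2%:E)%E].

Definition proper_efun f : Prop := (forall x, (-oo < f x)%E) /\ edom f !=set0.

Definition closed_efun f : Prop := closed (epigraph f).

(* Stated on the epigraph because f may a priori take both infinite values, where
   +oo and -oo would have to be added in the pointwise inequality. *)
Definition convex_efun f : Prop := convex_set (epigraph f).

Definition argmin f : set V := [set x | forall y, (f x <= f y)%E].

Definition subdiff f (x : V) : set V :=
  [set w | forall y, (f x + (inner w (y - x))%:E <= f y)%E].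

End ConvexAnalysis.

Definition gph {X Y : Type} (T : X -> set Y) : set (X * Y) :=
  [set p | T p.1 p.2].

Section Decomposition.
Context {R : realType} {H : hilbertType R}.

Definition orthogonal_decomposition (Hs Hss : {vspace H}) : Prop :=
  (Hs + Hss)%VS = fullv /\ (Hs <= orthov inner Hss)%VS.

Variables Hs Hss : {vspace H}.

(* The element of H written (z_*, z_** ) through its components. *)
Definition join_comp (zs : subvs_of Hs) (zss : subvs_of Hss) : H :=
  vsval zs + vsval zss.

Definition projected (T : H -> set H) (zs : subvs_of Hs) :
    set (subvs_of Hs) :=
  [set ws | exists zss, T (join_comp zs zss) (join_comp ws 0)].

Definition completion (T : H -> set H) (zs ws : subvs_of Hs) :
    set (subvs_of Hss) :=
  [set zss | T (join_comp zs zss) (join_comp ws 0)].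

Definition f_inf (f : H -> \bar R) (zs : subvs_of Hs) : \bar R :=
  ereal_inf (range (fun zss => f (join_comp zs zss))).

End Decomposition.

Arguments projected {R H} Hs Hss T zs.
Arguments completion {R H} Hs Hss T zs ws.
Arguments f_inf {R H} Hs Hss f zs.

(* Main.v *)
Require Import Defs.
From mathcomp Require Import all_boot all_order all_algebra.
From mathcomp Require Import all_classical all_reals all_analysis.
From mathcomp Require Import ring lra.
Import numFieldNormedType.Exports.
Local Open Scope classical_set_scope.

Set Implicit Arguments.
Unset Strict Implicit.
Unset Printing Implicit Defensive.

Import Order.TTheory GRing.Theory Num.Theory.
Local Open Scope ring_scope.

(* If argmin f(zh, .) is bounded, then f(zh, .) exceeds its minimum m on a sphere
   around a minimizer sh.  That sphere is compact and epi f is closed, so this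
   strict inequality persists for z near zh and levels near m.  A point (z, s) of
   a fixed sublevel set, with z bounded and s far away, is excluded by convexity:
   the segment joining it to (zh, sh) meets the sphere very close to z = zh, at a
   level very close to m.  Hence s stays bounded on {f <= a}, uniformly for z in
   bounded sets.  By compactness again, the infimum over s is attained and the
   projection of epi f, which is then epi finf, is closed.  Given a minimizer s
   of f(z, .), the subgradient inequalities of f at (z, s) for (w, 0) and of finf
   at z for w are the same. *)

(** * Compactness in finite-dimensional Hilbert spaces, through coordinates *)

Lemma fst_continuous (X Y : topologicalType) :
  continuous (@fst X Y : (X * Y)%type -> X).
Proof. by move=> p; exact: cvg_fst. Qed.

Lemma snd_continuous (X Y : topologicalType) :
  continuous (@snd X Y : (X * Y)%type -> Y).
Proof. by move=> p; exact: cvg_snd. Qed.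

Definition lincomb {R : realType} {V : hilbertType R} {n} (b : n.-tuple V)
  (v : 'rV[R]_n) : V := \sum_i v 0 i *: b`_i.

Section FiniteDimension.
Context {R : realType} {V : hilbertType R}.

Lemma lincomb_continuous n (b : n.-tuple V) : continuous (lincomb b).
Proof.
move=> v; rewrite /lincomb.
apply: (@cvg_big V 'I_n +%R 0 xpredT (@add_continuous V) _ _ _ _ _
  (nbhs_filter v)) => i _.
by apply: cvgZr_tmp; exact: coord_continuous.
Qed.

(** Freeness makes [|lincomb b v|] positive on the unit sphere of row vectors; compactness of that
    sphere gives a uniform lower bound [c], and homogeneity carries it to every [v]. *)
Lemma lincomb_norm_ge n (b : n.-tuple V) : free b ->
  exists2 c : R, 0 < c & forall v, c * `|v| <= `|lincomb b v|.
Proof.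
move=> bfree.
have Sc : compact [set v : 'rV[R]_n | `|v| = 1].
  apply: bounded_closed_compact.
    by exists 1; split=> // M M1 v /= ->; exact: ltW.
  apply: (@preimage_closed _ _ (fun v : 'rV[R]_n => `|v|) [set 1]).
    by move=> v _; exact: norm_continuous.
  exact: closed_eq.
(* Covering form of compactness: near each [v] on the sphere it is enough that [c] stays below half
   of [|lincomb b v|]. *)
have : \forall c \near 0^'+, [set v | `|v| = 1] `<=` [set v | c < `|lincomb b v|].
  move/compact_near_coveringP: Sc; apply => v /= v1.
  have bv0 : 0 < `|lincomb b v| / 2.
    rewrite divr_gt0 // normr_gt0; apply/negP => /eqP bv0.
    move: v1; suff -> : v = 0 by rewrite normr0 => /eqP; rewrite eq_sym oner_eq0.
    apply/rowP => i; rewrite mxE.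
    by have /freeP := bfree; apply; exact: bv0.
  near=> v' c => /=.
  rewrite (@lt_trans _ _ (`|lincomb b v| / 2)) //.
  near: v'.
  have : `|lincomb b v'| @[v' --> v] --> `|lincomb b v|.
    exact: (@cvg_norm _ _ _ _ (nbhs_filter v) _ _ (@lincomb_continuous _ b v)).
  move/(@cvgr_gt _ _ _ (nbhs_filter v)); apply.
  by rewrite ltr_pdivrMr // mulr2n mulrDr mulr1 ltrDl -(pmulr_lgt0 _ (_ : 0 < 2^-1)).
move=> bS; have /filter_ex[c [/= c0 cS]] : \forall c \near (0 : R)^'+, 0 < c /\
   [set v | `|v| = 1] `<=` [set v | c < `|lincomb b v|].
  by near=> c; split; [near: c; exact: nbhs_right_gt | near: c].
exists c => // v; have [->|v0] := eqVneq v 0; first by rewrite normr0 mulr0.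
have nv0 : 0 < `|v| by rewrite normr_gt0.
have lincombZ k : lincomb b (k *: v) = k *: lincomb b v.
  by rewrite /lincomb scaler_sumr; apply: eq_bigr => i _; rewrite mxE scalerA.
have /= := cS (`|v|^-1 *: v); rewrite lincombZ !normrZ normfV normr_id.
by rewrite mulVf ?gt_eqF // => /(_ erefl)/ltW; rewrite ler_pdivlMl // mulrC.
Unshelve. all: by end_near. Qed.

(** [A] is the continuous image of its set of coordinate vectors, which is closed by continuity and
    bounded by the lower estimate on [lincomb]. *)
Lemma bounded_closed_compact_hilbert (A : set V) :
  bounded_set A -> closed A -> compact A.
Proof.
move=> [M [Mreal AM]] Acl.
pose b := vbasis {:V}.
have [c c0 bc] := lincomb_norm_ge (basis_free (vbasisP {:V})).
have -> : A = lincomb b @` (lincomb b @^-1` A).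
  rewrite image_preimage //; apply/seteqP; split=> // x _.
  exists (\row_i coord b i x) => //.
  rewrite [RHS](coord_vbasis (memvf x)); apply: eq_bigr => i _.
  by rewrite mxE.
apply: continuous_compact.
  by apply: continuous_subspaceT; exact: lincomb_continuous.
apply: bounded_closed_compact; last first.
  by apply: preimage_closed => // v _; exact: lincomb_continuous.
(* [bounded_set] only controls norms by numbers strictly above [M], hence [M + 1]. *)
exists ((M + 1) / c); split; first exact: num_real.
move=> N MN v /= /AM - /(_ (M + 1)).
rewrite ltrDl ltr01 => /(_ isT) vM.
rewrite (le_trans _ (ltW MN)) // ler_pdivlMr // mulrC.
exact: le_trans (bc v) vM.
Qed.

Lemma dist_continuous (c : V) : continuous (fun s => `|s - c|).
Proof.
by move=> s; apply: cvg_norm; apply: cvgB; [exact: cvg_id | exact: cvg_cst].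
Qed.

Lemma ball_compact (c : V) r : compact [set s : V | `|s - c| <= r].
Proof.
apply: bounded_closed_compact_hilbert.
  exists (r + `|c|); split; first exact: num_real.
  move=> M rM s /= sr; apply: (le_trans _ (ltW rM)).
  by rewrite -{1}(subrK c s) (le_trans (ler_normD _ _)) // lerD2r.
apply: (@preimage_closed _ _ (fun s : V => `|s - c|) [set x | x <= r]).
  by move=> s _; exact: dist_continuous.
exact: closed_le.
Qed.

Lemma sphere_compact (c : V) r : compact [set s : V | `|s - c| = r].
Proof.
apply: (subclosed_compact _ (@ball_compact c r)) => [|s /= -> //].
apply: (@preimage_closed _ _ (fun s : V => `|s - c|) [set r]).
  by move=> s _; exact: dist_continuous.
exact: closed_eq.
Qed.

End FiniteDimension.

(** * Minimization of a closed convex function over its second variable *)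

Section PartialMinimization.
Context {R : realType} {X Y : hilbertType R}.
Variable g : X -> Y -> \bar R.

Hypothesis g_closed :
  closed [set p : (X * Y) * R^o | (g p.1.1 p.1.2 <= p.2%:E)%E].

(** A tube lemma: each [s] in [K] has a product neighbourhood that misses the closed epigraph, and
    compactness makes the [(z, a)] factor independent of [s]. *)
Lemma closed_compact_tube (K : set Y) (z0 : X) (a0 : R^o) : compact K ->
  (forall s, K s -> ~ (g z0 s <= a0%:E)%E) ->
  \forall p \near ((z0, a0) : X * R^o), K `<=` [set s | ~ (g p.1 s <= p.2%:E)%E].
Proof.
move=> /compact_near_coveringP Kc Kg.
apply: (Kc (X * R^o)%type (nbhs ((z0, a0) : X * R^o))
  (fun p s => ~ (g p.1 s <= p.2%:E)%E) (nbhs_filter _)) => s Ks.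
pose h (q : Y * (X * R^o)) : (X * Y) * R^o := ((q.2.1, q.1), q.2.2).
have hc : {for (s, (z0, a0)), continuous h}.
  apply: (@cvg_pair _ _ _ (nbhs _) (nbhs _) (nbhs _) _ _ _
    (fun q : Y * (X * R^o) => (q.2.1, q.1)) (fun q => q.2.2)); last first.
    exact: (cvg_comp _ _ (@snd_continuous _ _ _) (@snd_continuous _ _ _)).
  apply: (@cvg_pair _ _ _ (nbhs _) (nbhs _) (nbhs _) _ _ _
    (fun q : Y * (X * R^o) => q.2.1) fst); last exact: fst_continuous.
  exact: (cvg_comp _ _ (@snd_continuous _ _ _) (@fst_continuous _ _ _)).
apply: (hc (~` [set p : (X * Y) * R^o | (g p.1.1 p.1.2 <= p.2%:E)%E])).
by apply: open_nbhs_nbhs; split; [exact: closed_openC | exact: Kg].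
Qed.

Hypothesis g_convex : forall (t : R) z z' s s' (a a' : R), 0 <= t <= 1 ->
  (g z s <= a%:E)%E -> (g z' s' <= a'%:E)%E ->
  (g (t *: z + (1 - t) *: z')%R (t *: s + (1 - t) *: s')%R
    <= (t * a + (1 - t) * a')%:E)%E.

Lemma coercive zh sh (m rho : R) : 0 < rho -> (g zh sh <= m%:E)%E ->
  (forall s, `|s - sh| = rho -> ~ (g zh s <= m%:E)%E) ->
  forall r a : R, exists M, forall z s, `|z - zh| <= r -> (g z s <= a%:E)%E ->
    `|s - sh| <= M.
Proof.
move=> rho0 gm grho r a.
have /nbhs_ballP[d /= d0 dg] := closed_compact_tube (@sphere_compact _ _ sh rho) grho.
(* The summand [rho] gives [t <= 1] for [t := rho / D]; the other one gives
   [t * (|r| + |a - m| + 1) < d], so that the intermediate point falls into the tube. *)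
exists (rho * (`|r| + `|a - m| + 1) / d + rho) => z s zr gzs.
rewrite leNgt; apply/negP => sM.
have nr0 : 0 <= `|r| by [].
have nam0 : 0 <= `|a - m| by [].
have rhod0 : 0 < rho * (`|r| + `|a - m| + 1) / d.
  by rewrite divr_gt0 ?mulr_gt0//; lra.
set D := `|s - sh| in sM.
have D0 : 0 < D by lra.
pose t := rho / D.
have t0 : 0 < t by rewrite divr_gt0.
have t1 : t <= 1 by rewrite ler_pdivrMr // mul1r; lra.
have td : t * (`|r| + `|a - m| + 1) < d.
  rewrite /t mulrAC ltr_pdivrMr // -ltr_pdivrMl //; lra.
have tnr : 0 <= t * `|r| by rewrite mulr_ge0 // ltW.
have tam : 0 <= t * `|a - m| by rewrite mulr_ge0 // ltW.
have seg (V : lmodType R) (x y : V) : t *: x + (1 - t) *: y - y = t *: (x - y).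
  by rewrite scalerBl scale1r scalerBr addrA addrAC addrK.
have /= := @g_convex t z zh s sh a m _ gzs gm; rewrite (ltW t0) t1 => /(_ isT).
(* With weight [t] the second component is at distance exactly [rho] from [sh], where the tube
   forbids this level. *)
apply: (dg (t *: z + (1 - t) *: zh, t * a + (1 - t) * m)); last first.
  by rewrite /= seg normrZ gtr0_norm // /t divfK // gt_eqF.
split; rewrite -ball_normE /=.
  rewrite distrC seg normrZ gtr0_norm // (le_lt_trans _ td) //.
  rewrite ler_pM2l // (le_trans zr) // (le_trans (ler_norm r)) //; lra.
rewrite (_ : _ - _ = t * (m - a)); last by ring.
rewrite normrM gtr0_norm // distrC (le_lt_trans _ td) //.
rewrite ler_pM2l //; lra.
Qed.

Hypothesis g_gtNy : forall z s, (-oo < g z s)%E.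
Variable zh : X.
Hypothesis zh_dom : (ereal_inf (range (g zh)) < +oo)%E.
Hypothesis zh_argmin : argmin (g zh) !=set0.
Hypothesis zh_bounded : bounded_set (argmin (g zh)).

Lemma uniform_coercive (r a : R) : exists M, forall z s, `|z| <= r ->
  (g z s <= a%:E)%E -> `|s| <= M.
Proof.
have [sh shm] := zh_argmin; have [B [_ Bb]] := zh_bounded.
have gfin : g zh sh \is a fin_num.
  rewrite fin_numElt g_gtNy /= (le_lt_trans _ zh_dom) //.
  by apply: le_ereal_inf_tmp => _ [s _ <-]; exact: shm.
pose m := fine (g zh sh); have mE : m%:E = g zh sh by rewrite fineK.
(* All minimizers have norm at most [|B| + 1], while points at distance [rho] from [sh] have norm at
   least [|B| + 2]; so none of them can reach the level [m]. *)
pose rho := `|B| + `|sh| + 2.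
have rho0 : 0 < rho by rewrite ltr_wpDl // addr_ge0.
have grho s : `|s - sh| = rho -> ~ (g zh s <= m%:E)%E.
  rewrite mE => srho gs.
  have sm : argmin (g zh) s by move=> y; exact: le_trans gs (shm y).
  have sB : `|s| <= `|B| + 1 by apply: Bb sm; rewrite ltr_pwDr // ler_norm.
  have := ler_normB s sh; rewrite srho /rho; lra.
have [|M MP] := coercive rho0 _ grho (r + `|zh|) a; first by rewrite mE.
exists (M + `|sh|) => z s zr gzs.
have /MP/(_ gzs) := le_trans (ler_normB z zh) (lerD zr (lexx _)).
have := ler_normD (s - sh) sh; rewrite subrK; lra.
Qed.

(** Once infima are known to be attained, this projection is the epigraph of the infimal function,
    which thereby inherits closedness and convexity. *)
Definition epi_proj := [set p : X * R^o | exists s, (g p.1 s <= p.2%:E)%E].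

Lemma epi_proj_closed : closed epi_proj.
Proof.
rewrite -[epi_proj]setCK; apply: open_closedC; rewrite openE => -[z a] /= za.
(* The margins of 1 let one [M] serve a whole unit neighbourhood of [(z, a)]: there the only
   candidates [s] lie in a compact ball, which the tube rules out. *)
have [M MP] := uniform_coercive (`|z| + 1) (a + 1).
have : \forall p \near ((z, a) : X * R^o),
    [set s : Y | `|s - 0| <= M] `<=` [set s | ~ (g p.1 s <= p.2%:E)%E].
  apply: closed_compact_tube; first exact: ball_compact.
  by move=> s _ gs; apply: za; exists s.
move=> tube; rewrite /interior /=.
have nb : \forall p \near ((z, a) : X * R^o), `|p.1| <= `|z| + 1 /\ p.2 <= a + 1.
  apply/nbhs_ballP; exists 1; first exact: ltr01.
  move=> [z' a'] [] /=; rewrite -!ball_normE /= => zz' aa'; split.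
    have := ler_normB z (z - z'); rewrite subKr; lra.
  by rewrite -lerBlDl (le_trans (ler_norm _)) // distrC ltW.
apply: filterS2 tube nb => -[z' a'] /= tub [z'z a'a] [s /= gs].
apply: (tub s) => //=; rewrite subr0; apply: MP z'z _.
by apply: le_trans gs _; rewrite lee_fin.
Qed.

(** The sublevel set at 0 lies in a compact ball, and on that ball closedness of the epigraph keeps
    [g z] above some real level. *)
Lemma inf_gtNy z : (-oo < ereal_inf (range (g z)))%E.
Proof.
have [M MP] := uniform_coercive `|z| 0.
have : \forall a \near (-oo%R : set_system R^o),
    [set s : Y | `|s - 0| <= M] `<=` [set s | ~ (g z s <= a%:E)%E].
  have /compact_near_coveringP h := @ball_compact _ Y 0 M.
  apply: (h _ (-oo%R : set_system R^o) (fun a s => ~ (g z s <= a%:E)%E)) => s _.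
  have [b bs] : exists b : R^o, ~ (g z s <= b%:E)%E.
    have := g_gtNy z s; case: (g z s) => // [x _|_]; last by exists 0.
    by exists (x - 1); apply/negP; rewrite lee_fin -ltNge ltrBlDr ltrDl.
  have hc : {for s, continuous (fun s' => ((z, s'), b) : (X * Y) * R^o)}.
    apply: (@cvg_pair _ _ _ (nbhs _) (nbhs _) (nbhs _)); last exact: cvg_cst.
    by apply: (@cvg_pair _ _ _ (nbhs _) (nbhs _) (nbhs _));
    [exact: cvg_cst|exact: cvg_id].
  have nb : \forall s' \near s, ~ (g z s' <= b%:E)%E.
    apply: (hc (~` [set p : (X * Y) * R^o | (g p.1.1 p.1.2 <= p.2%:E)%E])).
    by apply: open_nbhs_nbhs; split; [exact: closed_openC | exact: bs].
  near=> s' a => /= gs'; have : ~ (g z s' <= b%:E)%E by near: s'.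
  apply; apply: le_trans gs' _; rewrite lee_fin ltW //.
  by near: a; apply: nbhs_ninfty_lt; exact: num_real.
move=> near_oo; rewrite ltNye; apply/eqP => infNy.
have [a tub] := filter_ex near_oo.
(* Being below 0 puts [s] in the ball; being below [a] then contradicts the bound there. *)
have /ereal_inf_lt[_ [s _ <-] gs] : (ereal_inf (range (g z)) < (Num.min a 0)%:E)%E.
  by rewrite infNy ltNyr.
have /= := tub s; apply.
  rewrite subr0; apply: (MP z) => //; apply: le_trans (ltW gs) _.
  by rewrite lee_fin ge_min lexx orbT.
by apply: le_trans (ltW gs) _; rewrite lee_fin ge_min lexx.
Unshelve. all: by end_near. Qed.

(** The slice of [epi_proj] above [z] is closed and contains every real level above the infimum,
    hence the infimum itself. *)
Lemma inf_attained z a : (ereal_inf (range (g z)) <= a%:E)%E <->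
  exists s, (g z s <= a%:E)%E.
Proof.
split=> [za|[s gs]]; last by apply: le_trans gs; apply: ereal_inf_lbound; exists s.
pose r := fine (ereal_inf (range (g z))).
have rE : r%:E = ereal_inf (range (g z)).
  by rewrite fineK // fin_numElt inf_gtNy (le_lt_trans za) ?ltry.
suff [s gs] : epi_proj (z, r) by exists s; apply: le_trans gs _; rewrite rE.
have : closed [set b : R^o | epi_proj (z, b)].
  apply: (@preimage_closed _ _ (fun b : R^o => (z, b) : X * R^o)); last first.
    exact: epi_proj_closed.
  by move=> b _; apply: (@cvg_pair _ _ _ (nbhs _) (nbhs _) (nbhs _));
    [exact: cvg_cst|exact: cvg_id].
move=> cl; apply: (cl r) => U /nbhs_ballP[e /= e0 eU].
have : (ereal_inf (range (g z)) < (r + e / 2)%:E)%E.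
  by rewrite -rE lte_fin ltrDl divr_gt0.
move/ereal_inf_lt => [_ [s _ <-] gs].
exists (r + e / 2); split; first by exists s; exact: ltW.
apply: eU; rewrite -ball_normE /= opprD addNKr normrN gtr0_norm ?divr_gt0 //.
lra.
Qed.

Lemma inf_argmin z : (ereal_inf (range (g z)) < +oo)%E ->
  argmin (g z) !=set0 /\ bounded_set (argmin (g z)).
Proof.
move=> zdom.
have rE : (fine (ereal_inf (range (g z))))%:E = ereal_inf (range (g z)).
  by rewrite fineK // fin_numElt inf_gtNy.
move: rE; set r := fine _ => rE.
have [s gs] : exists s, (g z s <= r%:E)%E by apply/inf_attained; rewrite rE.
split.
  by exists s => y; apply: le_trans gs _; rewrite rE; apply: ereal_inf_lbound; exists y.
have [M MP] := uniform_coercive `|z| r.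
exists M; split; first exact: num_real.
move=> N MN y ym; apply: le_trans (ltW MN); apply: (MP z) => //.
exact: le_trans (ym s) gs.
Qed.

End PartialMinimization.

(** * Convex combinations and components in the orthogonal sum *)

Lemma convex_setP (R : realType) (V : lmodType R) (A : set V) :
  convex_set A <-> forall (t : R) x y, 0 <= t <= 1 -> A x -> A y ->
    A (t *: x + (1 - t) *: y).
Proof.
split=> [Ac t x y t01 Ax Ay|Ac x y t]; last first.
  by rewrite !inE => Ax Ay; apply: Ac => //; apply/andP; split.
have := Ac x y (Itv01 (andP t01).1 (andP t01).2).
by rewrite !inE; apply.
Qed.

Section Components.
Context {R : realType} {H : hilbertType R} {Hs Hss : {vspace H}}.

Lemma vsval_continuous (U : {vspace H}) : continuous (vsval : subvs_of U -> H).
Proof.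
move=> x; apply/(@cvgrPdist_lt _ _ _ _ (nbhs_filter x)) => e e0.
apply/nbhs_ballP; exists e => // y; rewrite -ball_normE /=.
Qed.

Lemma join_comp_continuous :
  continuous (fun p : subvs_of Hs * subvs_of Hss => join_comp p.1 p.2).
Proof.
move=> p; apply: (@cvgD _ _ _ (nbhs p) (nbhs_filter p)).
  exact: (cvg_comp _ _ (@fst_continuous _ _ p) (@vsval_continuous Hs p.1)).
exact: (cvg_comp _ _ (@snd_continuous _ _ p) (@vsval_continuous Hss p.2)).
Qed.

Lemma join_compP (x : H) : (Hs + Hss)%VS = fullv ->
  exists (zs : subvs_of Hs) (zss : subvs_of Hss), x = join_comp zs zss.
Proof.
move=> HH; have : x \in (Hs + Hss)%VS by rewrite HH memvf.
move=> /memv_addP[u uH [v vH ->]].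
by exists (Subvs uH), (Subvs vH).
Qed.

Lemma join_comp_comb (t : R) (z z' : subvs_of Hs) (s s' : subvs_of Hss) :
  join_comp (t *: z + (1 - t) *: z') (t *: s + (1 - t) *: s') =
  t *: join_comp z s + (1 - t) *: join_comp z' s' :> H.
Proof. by rewrite /join_comp !linearD !linearZ /= addrACA. Qed.

(** Orthogonality kills the pairing of [ws] with the [Hss] part. Subgradient inequalities of [f] for
    [(ws, 0)] thus see only the [Hs] displacement. *)
Lemma inner_join_comp (ws zs ys : subvs_of Hs) (zss yss : subvs_of Hss) :
  (Hs <= orthov inner Hss)%VS ->
  inner (join_comp ws (0 : subvs_of Hss)) (join_comp ys yss - join_comp zs zss)
    = (inner : {dot subvs_of Hs for idfun}) ws (ys - zs).
Proof.
move=> /orthovP HsHss.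
rewrite /join_comp linear0 addr0 opprD addrACA -!linearB linearDr /=.
by rewrite (HsHss _ _ (subvsP ws) (subvsP (yss - zss))) addr0.
Qed.

End Components.

(** * Application to [f] and comparison of the subdifferentials *)

Theorem theorem4p7 (R : realType) (H : hilbertType R) (Hs Hss : {vspace H})
    (HsHss : orthogonal_decomposition Hs Hss)
    (f : H -> \bar R)
    (f_proper : proper_efun f) (f_closed : closed_efun f) (f_convex : convex_efun f) :
  let T := subdiff f in
  let finf := f_inf Hs Hss f in
  let Ts := projected Hs Hss T in
  let Tss := completion Hs Hss T in
  let argmin_ss (zs : subvs_of Hs) : set (subvs_of Hss) :=
    argmin (fun zss : subvs_of Hss => f (join_comp zs zss)) in
  (exists2 zs_hat : subvs_of Hs, edom finf zs_hat &
    argmin_ss zs_hat !=set0 /\ bounded_set (argmin_ss zs_hat)) ->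
  [/\ closed_efun finf, proper_efun finf & convex_efun finf] /\
  (forall zs, edom finf zs ->
    argmin_ss zs !=set0 /\ bounded_set (argmin_ss zs)) /\
  Ts = subdiff finf /\
  (forall zs ws, gph Ts (zs, ws) -> Tss zs ws = argmin_ss zs).
Proof.
move=> T finf Ts Tss argmin_ss [zh zh_dom [zh_argmin zh_bdd]].
have [HH Horth] := HsHss; have [f_gtNy f_dom] := f_proper.
pose g (zs : subvs_of Hs) (zss : subvs_of Hss) := f (join_comp zs zss).
have g_closed : closed [set p : (subvs_of Hs * subvs_of Hss) * R^o |
    (g p.1.1 p.1.2 <= p.2%:E)%E].
  apply: (@preimage_closed _ _ (fun p : (subvs_of Hs * subvs_of Hss) * R^o =>
    (join_comp p.1.1 p.1.2, p.2)) (epigraph f)) => // p _.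
  apply: (@cvg_pair _ _ _ (nbhs p) (nbhs _) (nbhs _)); last exact: cvg_snd.
  exact: (cvg_comp _ _ (@fst_continuous _ _ p) (@join_comp_continuous _ _ _ _ p.1)).
have g_convex (t : R) z z' s s' (a a' : R) : 0 <= t <= 1 ->
    (g z s <= a%:E)%E -> (g z' s' <= a'%:E)%E ->
    (g (t *: z + (1 - t) *: z')%R (t *: s + (1 - t) *: s')%R
      <= (t * a + (1 - t) * a')%:E)%E.
  move=> t01 gz gz'; rewrite /g join_comp_comb.
  exact: (convex_setP _).1 f_convex t (_, a) (_, a') t01 gz gz'.
have g_gtNy z s : (-oo < g z s)%E by exact: f_gtNy.
have attained := inf_attained g_closed g_convex g_gtNy zh_dom zh_argmin zh_bdd.
have argminP := inf_argmin g_closed g_convex g_gtNy zh_dom zh_argmin zh_bdd.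
have finf_gtNy := inf_gtNy g_closed g_convex g_gtNy zh_dom zh_argmin zh_bdd.
have finf_le zs zss : (finf zs <= g zs zss)%E.
  by apply: ereal_inf_lbound; exists zss.
have finfE zs zss : argmin_ss zs zss -> finf zs = g zs zss.
  move=> m; apply/eqP; rewrite eq_le finf_le /=.
  by apply: le_ereal_inf_tmp => _ [s _ <-]; exact: m.
have epiE : epigraph finf = epi_proj g.
  by apply/seteqP; split=> -[z a] /=; rewrite /epigraph /= attained.
have subdiff_argmin (zs ws : subvs_of Hs) (zss : subvs_of Hss) :
    T (join_comp zs zss) (join_comp ws (0 : subvs_of Hss)) ->
    argmin_ss zs zss.
  (* Against points with the same [zs] the linear term vanishes, so the subgradient inequality
     becomes minimality. *)
  move=> Tz s; have := Tz (join_comp zs s).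
  by rewrite inner_join_comp // subrr linear0 adde0.
have subdiffE zs ws zss : argmin_ss zs zss ->
    T (join_comp zs zss) (join_comp ws (0 : subvs_of Hss)) <-> subdiff finf zs ws.
  move=> m; split => [Tz y|Sz x].
    apply: le_ereal_inf_tmp => _ [s _ <-]; rewrite (finfE _ _ m).
    by have := Tz (join_comp y s); rewrite inner_join_comp.
  (* Conversely, every test point splits into components, and [finf ys] bounds [f] from below on the
     fibre over [ys]. *)
  have [ys [yss ->]] := join_compP x HH.
  rewrite inner_join_comp // -[f _]/(g zs zss) -(finfE _ _ m).
  exact: le_trans (Sz ys) (finf_le _ _).
split; [split|split; [exact: argminP|split]].
- by rewrite /closed_efun epiE; exact: epi_proj_closed zh_dom zh_argmin zh_bdd.
- by split=> //; exists zh.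
- rewrite /convex_efun epiE; apply/convex_setP => t [z a] [z' a'] t01 [s gs] [s' gs'].
  by exists (t *: s + (1 - t) *: s'); exact: g_convex.
- apply/funext => zs; apply/seteqP; split=> ws.
    by move=> [zss Tz]; apply/(subdiffE _ _ zss) => //; exact: subdiff_argmin Tz.
  move=> Sz; have [[zss m] _] : argmin_ss zs !=set0 /\ bounded_set (argmin_ss zs).
    (* A subgradient forces [finf zs] to be finite: if it were [+oo], the inequality tested at [zh]
       would make [finf zh] infinite. *)
    apply: argminP; rewrite ltey; apply/eqP => zsy.
    have : (finf zs + _ <= finf zh)%E := Sz zh.
    rewrite [finf zs]zsy addye // leye_eq => /eqP zhy.
    by move: zh_dom; rewrite /edom /= zhy.
  by exists zss; apply/subdiffE.
- move=> zs ws [s0 Tz0]; apply/seteqP; split=> zss.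
    exact: subdiff_argmin.
  (* By [subdiffE] the subgradient condition is the same for all minimizers over [zs], so it passes
     from [s0] to [zss]. *)
  move=> m; apply/subdiffE => //; apply/(subdiffE _ _ s0) => //.
  exact: subdiff_argmin Tz0.
Qed.
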